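(* Let $G$ be a finite solvable group and suppose given integers $n(H,\phi)$ for all pairs $(H,\phi)$ with $H$ a subgroup of $G$ and $\phi$ a character of $H$, satisfying: (ACH1) $n(H,\phi_1+\phi_2)=n(H,\phi_1)+n(H,\phi_2)$ for all characters $\phi_1,\phi_2$ of $H$; (ACH2) $n(G,\mathrm{Ind}_H^G\phi)=n(H,\phi)$ for every subgroup $H$ and every character $\phi$ of $H$; (ACH3) $n(H,\phi)\ge0$ for every subgroup $H$ and every one-dimensional character $\phi$ of $H$. Let $\chi_0$ be a one-dimensional character of $G$. Then \[\sum_{\chi\in\mathrm{Irr}(G)\setminus\{\chi_0\}}n(G,\chi)^2\le\big(n(G,\mathrm{Reg}_G)-n(G,\chi_0)\big)^2.\]
   Context: $\mathrm{Irr}(G)$ is the set of irreducible complex characters of $G$ and $\mathrm{Reg}_G=\sum_{\chi\in\mathrm{Irr}(G)}\chi(1)\chi$ is the regular character. $\mathrm{Ind}_H^G$ denotes induction of characters. *)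

(* Defs.v *)
From HB Require Import structures.
From mathcomp Require Import all_boot all_order all_algebra all_fingroup all_solvable all_field all_character.

(* Main.v *)
(* Let Theta be the sum of the n(G, chi) chi. By (ACH2) and Frobenius reciprocity
   its restriction to a subgroup C is the sum of the n(C, psi) psi, and for C
   cyclic every psi is linear with n(C, psi) >= 0. To keep this positivity after
   removing the chi0-part of Theta one needs n(G, chi0) <= n(C, Res chi0), which
   is proved by descending along a chain of maximal subgroups M < L: when L is
   solvable, every constituent of Ind_M^L 1 is induced from a linear character
   (Uchida, van der Waall), so that Ind_M^L (Res chi0) - chi0 is a sum of such
   characters. Hence |Theta - n(G, chi0) chi0| is bounded on each cyclic C by
   its value n(G, Reg) - n(G, chi0) at 1, and the theorem follows by taking
   norms. *)

Require Import Defs.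
From HB Require Import structures.
From mathcomp Require Import all_boot all_order all_algebra all_fingroup all_solvable all_field all_character.
Import Order.TTheory GRing.Theory Num.Theory.
Local Open Scope ring_scope.

(** If [g = u * m], the [y] in [N] with [y^-1 * g] in [M] form the coset of [M :&: N] through [u],
    so each [g] is counted [#|M :&: N|] times. *)
Lemma sum_mulg_groups (R : nmodType) (gT : finGroupType) (M N : {group gT})
    (f : gT -> R) :
  \sum_(y in N) \sum_(m in M) f (y * m)%g
    = (\sum_(g in (N * M)%g) f g) *+ #|M :&: N|.
Proof.
transitivity (\sum_(y in N) \sum_(g in (N * M)%g | (y^-1 * g)%g \in M) f g).
  apply: eq_bigr => y Ny; rewrite (reindex_inj (mulgI y^-1%g)) /=.
  apply: eq_big => [g | g _]; last by rewrite mulKVg.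
  case Mg: (_ \in M); rewrite ?andbF ?andbT //.
  by rewrite -(mulKVg y g) mem_mulg.
rewrite (exchange_big_dep (fun g => g \in (N * M)%g)) /= => [|y g _ /andP[]//].
rewrite -sumrMnl; apply: eq_bigr => g /mulsgP[u m Nu Mm ->].
rewrite sumr_const; congr (_ *+ _).
rewrite -(card_lcoset (M :&: N) u); apply: eq_card => y.
rewrite mem_lcoset !inE unfold_in /= mulgA groupMr // mem_mulg //=.
by rewrite andbC (groupMl _ (groupVr Nu)) -[in LHS]groupV invMg invgK.
Qed.

(* Mackey's formula in the case of a single double coset. *)
Lemma cfRes_Ind_mulg (gT : finGroupType) (G M N : {group gT}) (phi : 'CF(M)) :
  (M * N)%g = G ->
  'Res[N] ('Ind[G] phi) = 'Ind[N] ('Res[M :&: N] phi).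
Proof.
move=> defG; have [sMG sNG] : M \subset G /\ N \subset G.
  by rewrite -defG mulG_subl mulG_subr.
have /comm_group_setP cMN : group_set (M * N)%g by rewrite defG groupP.
have defG' : (N * M)%g = G by rewrite -cMN.
apply/cfun_inP=> x Nx; rewrite cfResE // !cfIndE ?subsetIr //.
have phiM y m (Mm : m \in M) : phi (x ^ (y * m))%g = phi (x ^ y)%g.
  by rewrite conjgM [LHS]cfunJ.
have := sum_mulg_groups _ _ M N (fun y => phi (x ^ y)%g); rewrite defG'.
under eq_bigr => y _ do
  (under eq_bigr => m Mm do rewrite phiM //; rewrite sumr_const).
rewrite sumrMnl => eqM.
(* The conjugates [x ^ y] stay in [N], and [phi] vanishes off [M]. *)
have -> : \sum_(y in N) ('Res[M :&: N] phi) (x ^ y)%g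
          = \sum_(y in N) phi (x ^ y)%g.
  apply: eq_bigr => y Ny; have [Kxy | K'xy] := boolP (x ^ y \in M :&: N)%g.
    by rewrite cfResE ?subsetIl.
  rewrite !cfun0 //; apply: contra K'xy => Mxy.
  by rewrite inE Mxy groupJ.
rewrite [LHS]mulrC [RHS]mulrC; apply/eqP; rewrite eqr_div ?neq0CG //.
by rewrite !mulr_natr eqM.
Qed.

(* N is the last term of the derived series of G not contained in M. *)
Lemma maximal_sol_supplement (gT : finGroupType) (G M : {group gT}) :
  solvable G -> maximal M G ->
  exists N : {group gT},
    [/\ (N <| G)%g, (N^`(1) \subset M)%g & (M * N)%g = G].
Proof.
move=> /derivedP exk maxM.
have sMG := proper_sub (maxgroupp maxM).
have: exists k, (G^`(k) \subset M)%g by case: exk => k dG1; exists k; rewrite dG1 sub1G.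
move/ex_minnP => [[|k] sDM min_k].
  by case/idPn: sDM; rewrite derg0; case/andP: (maxgroupp maxM).
have not_sDM : ~~ (G^`(k) \subset M)%g by apply/negP => /min_k; rewrite ltnn.
exists (G^`(k))%G; split; [exact: der_normal | by rewrite derg1 -dergSn | ].
have nDM : M \subset 'N(G^`(k))%g.
  exact: subset_trans sMG (normal_norm (der_normal _ _)).
rewrite -norm_joinEl //; case/maxgroupP: maxM => _ maxM; apply/eqP.
rewrite eqEproper join_subG sMG der_sub /=; apply: contra not_sDM => ltMD.
by rewrite -(maxM _ ltMD (joing_subl _ _)) joing_subr.
Qed.

(* With N as above and lambda a constituent of the restriction of chi to N,
   Mackey's formula forces lambda to be linear of multiplicity 1; the Clifford
   correspondent of chi over lambda then has degree 1. *)
Lemma constt_Ind_maximal_monomial (gT : finGroupType) (G M : {group gT})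
    (i : Iirr G) :
  solvable G -> maximal M G -> i \in irr_constt ('Ind[G, M] 1) ->
  exists (T : {group gT}) (psi : 'CF(T)),
    [/\ T \subset G, psi \is a linear_char & 'chi_i = 'Ind[G] psi].
Proof.
move=> solG maxM i1.
have [N [nsNG sN'M defG]] := maximal_sol_supplement _ _ _ solG maxM.
have [t it] := constt_cfRes_irr N i.
(* The complement of ['chi_i] in ['Ind[G, M] 1] is a character, so it only adds to the multiplicity
   of ['chi_t]. *)
have le_it : '['Res[N] 'chi_i, 'chi_t] <= '['Ind[N, M :&: N] 1, 'chi_t].
  have <- : 'Res[N] ('Ind[G, M] 1) = 'Ind[N, M :&: N] 1.
    by rewrite (cfRes_Ind_mulg _ _ _ _ _ defG) cfRes_cfun1.
  have /constt_charP[|phi Nphi ->] := i1; first by rewrite cfInd_char ?cfun1_char.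
  rewrite linearD cfdotDl lerDl natr_ge0 // Cnat_cfdot_char_irr //.
  exact: cfRes_char.
have [Nit nz_it] : '['Res[N] 'chi_i, 'chi_t] \is a Num.nat
                   /\ '['Res[N] 'chi_i, 'chi_t] != 0.
  by rewrite Cnat_cfdot_char_irr ?cfRes_char ?irr_char -?irr_consttE.
have lin_t : 'chi_t \is a linear_char.
  have sN'K : (N^`(1) \subset M :&: N)%g by rewrite subsetI sN'M der_sub.
  rewrite lin_irr_der1; apply: subset_trans (sN'K) _; apply: constt0_Res_cfker.
    by rewrite sub_der1_normal ?subsetIr.
  rewrite -constt_Ind_Res irr_consttE irr0 gt_eqF //.
  by apply: lt_le_trans le_it; rewrite lt_def nz_it natr_ge0.
have it1 : '['Res[N] 'chi_i, 'chi_t] = 1.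
  have /natrP[m Dm] := Nit; rewrite Dm in nz_it le_it *.
  suffices le_m1 : m%:R <= 1 :> algC.
    apply/eqP; rewrite pnatr_eq1 eqn_leq lt0n -(pnatr_eq0 algC) nz_it.
    by rewrite -(ler_nat algC) le_m1.
  (* By reciprocity the bound is a product of two linear characters of [M :&: N], which is 0 or
     1. *)
  apply: le_trans le_it _; rewrite -Frobenius_reciprocity.
  have /irrP[u ->] := lin_char_irr (cfRes_lin_char (M :&: N)%G lin_t).
  by rewrite -irr0 cfdot_irr; case: (_ == _); rewrite ?ler01 ?lexx.
have [irrT _ bij _ eq_res] := constt_Inertia_bijection t nsNG.
have := it; rewrite -constt_Ind_Res -bij => /imsetP[s st Di].
have Di' : 'chi_i = 'Ind 'chi_s by rewrite Di cfIirrE // irrT.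
exists 'I_G['chi_t]%G, 'chi_s; split; rewrite ?Inertia_sub //.
rewrite qualifE /= irr_char /=.
(* ['chi_t] is its own only conjugate in its inertia group, so ['chi_s] restricts to ['chi_t] taken
   once. *)
have nsNT : (N <| 'I_G['chi_t])%g by rewrite normal_Inertia ?normal_sub.
rewrite -(cfRes1 N) (Clifford_Res_sum_cfclass nsNT (j := t)); last by rewrite -constt_Ind_Res.
by rewrite cfclass_inertia big_seq1 eq_res // -Di' it1 scale1r lin_char1.
Qed.

Section ArithmeticHeilbronn.

Variables (gT : finGroupType) (G : {group gT}).
Variable n : forall H : {group gT}, 'CF(H) -> int.
Hypothesis ACH1 : forall H : {group gT}, H \subset G ->
  forall phi1 phi2 : 'CF(H), phi1 \is a character -> phi2 \is a character ->
  n H (phi1 + phi2) = n H phi1 + n H phi2.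
Hypothesis ACH2 : forall H : {group gT}, H \subset G ->
  forall phi : 'CF(H), phi \is a character -> n G ('Ind[G, H] phi) = n H phi.
Hypothesis ACH3 : forall H : {group gT}, H \subset G ->
  forall phi : 'CF(H), phi \is a linear_char -> 0 <= n H phi.

Lemma ach_sum (H : {group gT}) (sHG : H \subset G) (I : Type) (r : seq I)
    (P : pred I) (F : I -> 'CF(H)) :
  (forall i, P i -> F i \is a character) ->
  n H (\sum_(i <- r | P i) F i) = \sum_(i <- r | P i) n H (F i).
Proof.
move=> chF.
(* Being a character is carried through the induction so that [ACH1] applies; the empty sum uses
   [0 + 0 = 0]. *)
have [//] : n H (\sum_(i <- r | P i) F i) = \sum_(i <- r | P i) n H (F i)
  /\ \sum_(i <- r | P i) F i \is a character.
apply: (big_rec2 (fun a b => n H a = b /\ a \is a character)) => [|i y1 y2 Pi [<- chy]].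
  split; last exact: cfun0_char.
  have := ACH1 H sHG 0 0 (cfun0_char _) (cfun0_char _).
  by rewrite addr0 -[LHS]addr0 => /addrI.
by rewrite ACH1 ?chF // rpredD ?chF.
Qed.

Lemma ach_cfdot (H : {group gT}) (phi : 'CF(H)) :
  H \subset G -> phi \is a character ->
  (n H phi)%:~R = \sum_i '[phi, 'chi_i] * (n H 'chi_i)%:~R :> algC.
Proof.
move=> sHG chphi; have Nphi i := natrP (Cnat_cfdot_char_irr i chphi).
rewrite {1}[phi]cfun_sum_cfdot ach_sum // => [|i _]; last first.
  by have [k ->] := Nphi i; rewrite scaler_nat rpredMn ?irr_char.
rewrite rmorph_sum; apply: eq_bigr => i _; have [k ->] := Nphi i.
rewrite scaler_nat -[in LHS](subn0 k) -sumr_const_nat ach_sum // => [|j _]; last exact: irr_char.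
by rewrite sumr_const_nat subn0 rmorphMn /= mulr_natl.
Qed.

(** Transitivity of induction: both sides equal the value of [n G] on the character induced to
    [G]. *)
Lemma ach_cfInd (L H : {group gT}) (phi : 'CF(H)) :
  H \subset L -> L \subset G -> phi \is a character -> n L ('Ind[L] phi) = n H phi.
Proof.
move=> sHL sLG chphi; rewrite -ACH2 ?cfInd_char // cfIndInd //.
by rewrite ACH2 // (subset_trans sHL).
Qed.

(** Inducing ['Res[M] mu] to [L] gives [mu * 'Ind[L, M] 1], that is [mu] plus products
    [mu * 'chi_i]; each of these is induced from a linear character, so [ACH3] applies. *)
Lemma ach_le_maximal (L M : {group gT}) (mu : 'CF(L)) :
  solvable L -> L \subset G -> maximal M L -> mu \is a linear_char ->
  n L mu <= n M ('Res[M] mu).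
Proof.
move=> solL sLG maxM lin_mu; have sML := proper_sub (maxgroupp maxM).
have chmu := lin_charW lin_mu.
have chInd1 : 'Ind[L, M] 1 \is a character by rewrite cfInd_char ?cfun1_char.
have : 0 \in irr_constt ('Ind[L, M] 1).
  by rewrite irr_consttE irr0 -Frobenius_reciprocity cfRes_cfun1 cfnorm1 oner_eq0.
case/constt_charP=> // psi chpsi Dpsi.
rewrite -(@ach_cfInd L M) ?cfRes_char // -[X in 'Ind[L] X]mul1r cfIndM // Dpsi.
rewrite irr0 mulrDl mul1r ACH1 ?rpredM // lerDl.
have [r Dr] := char_sum_irr chpsi.
rewrite Dr mulr_suml ach_sum // => [|i _]; last by rewrite rpredM ?irr_char.
rewrite big_seq sumr_ge0 // => i ri.
have i1 : i \in irr_constt ('Ind[L, M] 1).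
  apply/constt_charP=> //; exists ('chi_0 + \sum_(j <- rem i r) 'chi_j).
    by rewrite rpredD ?irr_char // rpred_sum // => j _; apply: irr_char.
  by rewrite Dpsi Dr (big_rem i) //= addrCA.
have [T [lam [sTL lin_lam ->]]] := constt_Ind_maximal_monomial _ _ _ _ solL maxM i1.
rewrite -cfIndM // ach_cfInd ?rpredM ?cfRes_char ?lin_charW //.
by rewrite ACH3 ?rpredM ?cfRes_lin_char // (subset_trans sTL).
Qed.

Lemma ach_le_cfRes (L H : {group gT}) (mu : 'CF(L)) :
  solvable L -> L \subset G -> H \subset L -> mu \is a linear_char ->
  n L mu <= n H ('Res[H] mu).
Proof.
have [k] := ubnP #|L|; elim: k => // k IHk in L mu * => leLk solL sLG sHL lin_mu.
have [/group_inj-> | [M maxM sHM]] := maximal_exists sHL; first by rewrite cfRes_id.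
have ltML := maxgroupp maxM; have sML := proper_sub ltML.
apply: le_trans (ach_le_maximal _ _ _ solL sLG maxM lin_mu) _.
rewrite -(cfResRes _ sHM sML) IHk ?cfRes_lin_char //.
- exact: leq_trans (proper_card ltML) _.
- exact: solvableS sML solL.
- exact: subset_trans sML sLG.
Qed.

End ArithmeticHeilbronn.

Lemma cfInd_cfReg (gT : finGroupType) (G H : {group gT}) :
  H \subset G -> 'Ind[G] (cfReg H) = cfReg G.
Proof.
move=> sHG; apply/cfun_inP => x Gx; rewrite cfIndE // cfRegE.
under eq_bigr => y _ do rewrite cfRegE conjg_eq1.
by rewrite sumr_const 2!mulrnAr mulVf ?neq0CG // mulrnAC.
Qed.

Lemma cfnorm_sum_irr (gT : finGroupType) (G : {group gT}) (P : pred (Iirr G))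
    (a : Iirr G -> algC) :
  '[\sum_(i | P i) a i *: 'chi_i] = \sum_(i | P i) `|a i| ^+ 2.
Proof.
rewrite cfdot_suml; apply: eq_bigr => i Pi; rewrite cfdot_sumr (bigD1 i) //=.
rewrite big1 => [|j /andP[_ /negPf ne_ji]].
  by rewrite addr0 cfdotZl cfdotZr cfnorm_irr mulr1 normCK.
by rewrite cfdotZl cfdotZr cfdot_irr eq_sym ne_ji !mulr0.
Qed.

Lemma cfnorm_le_bound (gT : finGroupType) (G : {group gT}) (phi : 'CF(G))
    (b : algC) :
  (forall x, x \in G -> `|phi x| <= b) -> '[phi] <= b ^+ 2.
Proof.
move=> le_b; rewrite (cfnormE (cfun_onG phi)) ler_pdivrMl ?gt0CG //.
rewrite mulr_natl -sumr_const; apply: ler_sum => x Gx.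
by rewrite lerXn2r ?nnegrE ?le_b // (le_trans _ (le_b x Gx)).
Qed.

Theorem theorem5p3p1 (gT : finGroupType) (G : {group gT})
  (n : forall H : {group gT}, 'CF(H) -> int)
  (solG : solvable G)
  (ACH1 : forall H : {group gT}, H \subset G ->
     forall phi1 phi2 : 'CF(H), phi1 \is a character -> phi2 \is a character ->
       n H (phi1 + phi2) = n H phi1 + n H phi2)
  (ACH2 : forall H : {group gT}, H \subset G ->
     forall phi : 'CF(H), phi \is a character -> n G ('Ind[G, H] phi) = n H phi)
  (ACH3 : forall H : {group gT}, H \subset G ->
     forall phi : 'CF(H), phi \is a linear_char -> 0 <= n H phi)
  (chi0 : 'CF(G)) (lin_chi0 : chi0 \is a linear_char) :
  \sum_(i : Iirr G | 'chi_i != chi0) (n G 'chi_i) ^+ 2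
    <= (n G (cfReg G) - n G chi0) ^+ 2.
Proof.
rewrite -(ler_int algC) rmorph_sum rmorphXn /=.
rewrite (eq_bigr (fun i => `|(n G 'chi_i)%:~R : algC| ^+ 2)); last first.
  by move=> i _; rewrite rmorphXn /= intr_normK ?rpred_int.
rewrite -cfnorm_sum_irr; apply: cfnorm_le_bound => x Gx.
have /irrP[i0 Di0] := lin_char_irr lin_chi0.
rewrite -cycle_subG in Gx; set C := <[x]>%G.
have Cx : x \in C by apply: cycle_id.
have sCG : C \subset G by [].
have linC (j : Iirr C) : 'chi_j \is a linear_char.
  by rewrite irr_cyclic_lin ?cycle_cyclic.
have /irrP[j0 Dj0] := lin_char_irr (cfRes_lin_char C lin_chi0).
(* These are the coefficients on [C] of Theta minus its [chi0]-part; [j0] indexes the restriction of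
   [chi0]. *)
pose c j := n C 'chi_j - n G chi0 *+ (j == j0).
have c_ge0 j : 0 <= c j.
  rewrite /c; have [-> | _] := eqVneq j j0; last by rewrite subr0 ACH3.
  by rewrite subr_ge0 mulr1n -Dj0 (ach_le_cfRes _ _ _ ACH1 ACH2 ACH3).
(* This is the value at 1, since the regular character of [G] is induced from that of [C]. *)
have sum_c : \sum_j c j = n G (cfReg G) - n G chi0.
  rewrite sumrB -(cfInd_cfReg _ _ _ sCG) ACH2 ?cfReg_char // cfReg_sum.
  rewrite (ach_sum _ _ _ ACH1) // => [|j _]; last first.
    by rewrite lin_char1 // scale1r irr_char.
  congr (_ - _); first by apply: eq_bigr => j _; rewrite lin_char1 // scale1r.
  by rewrite (bigD1 j0) //= eqxx big1 ?addr0 // => j /negPf->.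
(* Triangle inequality: the [c j] are nonnegative and linear characters have values of modulus 1. *)
suff -> : (\sum_(i | 'chi_i != chi0) (n G 'chi_i)%:~R *: 'chi_i) x
          = \sum_j (c j)%:~R * 'chi_j x.
  apply: le_trans (ler_norm_sum _ _ _) _; rewrite -sum_c rmorph_sum ler_sum // => j _.
  by rewrite normrM (normC_lin_char (linC j)) // mulr1 ger0_norm ?ler0z.
(* Theta restricts to its analogue on [C]: expand each [n C 'chi_j] through ['Ind[G] 'chi_j], swap
   the sums and apply reciprocity. *)
have Theta_x : \sum_j (n C 'chi_j)%:~R * 'chi_j x
                 = \sum_i (n G 'chi_i)%:~R * 'chi_i x.
  under eq_bigr => j _.
    rewrite -ACH2 ?irr_char // (ach_cfdot _ _ _ ACH1) ?cfInd_char ?irr_char //.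
    rewrite mulr_suml; over.
  rewrite exchange_big; apply: eq_bigr => i _ /=.
  rewrite -['chi_i x](cfResE _ sCG Cx) ['Res _]cfun_sum_cfdot sum_cfunE mulr_sumr.
  apply: eq_bigr => j _; rewrite cfunE -Frobenius_reciprocity.
  rewrite cfdotC_char ?irr_char ?cfRes_char ?irr_char //.
  by rewrite mulrA [_ * _%:~R]mulrC.
rewrite sum_cfunE; under [RHS]eq_bigr => j _ do rewrite rmorphB mulrBl.
rewrite sumrB Theta_x [X in _ = _ - X](bigD1 j0) //= eqxx mulr1n.
rewrite [X in _ - (_ + X)]big1 => [|j /negPf->]; last by rewrite mul0r.
rewrite addr0 -Dj0 cfResE // Di0 [in RHS](bigD1 i0) //= addrAC subrr add0r.
apply: eq_big => [i | i _]; last by rewrite cfunE.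
by rewrite (inj_eq irr_inj).
Qed.
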